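(* A $5$-dimensional unimodular Sasakian Lie algebra with non-trivial center is isomorphic either to the nilpotent real Heisenberg Lie algebra $\mathfrak{h}_5$ or to the solvable Lie algebra $\mathfrak{g}_3$ with basis $e_1,\dots,e_5$ and nonzero brackets (up to skew-symmetry) $$[e_1,e_2]=-e_3,\quad [e_1,e_3]=e_2,\quad [e_1,e_4]=-e_5,\quad [e_2,e_3]=-e_5.$$ Moreover, the simply connected Lie group $G_3$ with Lie algebra $\mathfrak{g}_3$ admits a co-compact discrete subgroup $\Gamma$.
   Context: All Lie algebras are real. For a $1$-form $\alpha\in\mathfrak{g}^*$, $\mathrm{d}\alpha(X,Y)=-\alpha([X,Y])$. A Sasakian structure on a $(2n+1)$-dimensional Lie algebra $\mathfrak{g}$ is a quadruple $(\Phi,\alpha,\xi,g)$ with $\Phi\in\mathrm{End}(\mathfrak{g})$, $\alpha\in\mathfrak{g}^*$, $\xi\in\mathfrak{g}$ and $g$ an inner product on $\mathfrak{g}$ such that for all $X,Y\in\mathfrak{g}$: $\alpha(\xi)=1$; $\Phi^2=-\mathrm{I}+\xi\otimes\alpha$; $g(\Phi X,\Phi Y)=g(X,Y)-\alpha(X)\alpha(Y)$; $2g(X,\Phi Y)=\mathrm{d}\alpha(X,Y)$; and $N_\Phi=-\mathrm{d}\alpha\otimes\xi$, where $N_\Phi(X,Y)=\Phi^2[X,Y]+[\Phi X,\Phi Y]-\Phi[\Phi X,Y]-\Phi[X,\Phi Y]$. A Sasakian Lie algebra is a Lie algebra equipped with a Sasakian structure. $\mathfrak{h}_5$ has basis $X_1,X_2,Y_1,Y_2,Z$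 with only nonzero brackets $[X_i,Y_i]=Z$, $i=1,2$. A Lie algebra is unimodular if $\mathrm{tr}(\mathrm{ad}_X)=0$ for all $X$. *)

(* Defs.v *)
From HB Require Import structures.
From mathcomp Require Import all_boot all_order all_algebra generic_quotient.
From mathcomp Require Import sesquilinear ring.
From mathcomp Require Import all_classical all_reals all_analysis.

Set Implicit Arguments.
Unset Strict Implicit.
Unset Printing Implicit Defensive.

Import Order.TTheory GRing.Theory Num.Theory numFieldNormedType.Exports.
Local Open Scope classical_set_scope.
Local Open Scope quotient_scope.
Local Open Scope ring_scope.

HB.mixin Record Vector_isLie (R : fieldType) g of Vector R g := {
  lie : g -> g -> g;
  lie_bilinear : bilinear_for *:%R *:%R lie;
  liexx : forall x, lie x x = 0;
  lie_jacobi : forall x y z,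
    lie x (lie y z) + lie y (lie z x) + lie z (lie x y) = 0
}.

#[short(type="lieAlgType")]
HB.structure Definition LieAlgebra (R : fieldType) :=
  {g of Vector R g & Vector_isLie R g}.

Section LieAlgebraNotions.
Variables (R : fieldType) (g h : lieAlgType R).

Definition adjoint (x : g) : 'End(g) := linfun (lie x).

Definition lfun_trace (f : 'End(g)) : R :=
  \tr (passmx.mxof (vbasis {:g}) (vbasis {:g}) f).

Definition unimodular : Prop := forall x : g, lfun_trace (adjoint x) = 0.

Definition lie_center : set g := [set z | forall x, lie z x = 0].

Definition lie_isomorphic : Prop :=
  exists2 f : {linear g -> h}, bijective f &
    forall x y, f (lie x y) = lie (f x) (f y).

Definition ext_d (alpha : 'Hom(g, R^o)) (x y : g) : R := - alpha (lie x y).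

Definition nijenhuis (Phi : 'End(g)) (x y : g) : g :=
  Phi (Phi (lie x y)) + lie (Phi x) (Phi y)
    - Phi (lie (Phi x) y) - Phi (lie x (Phi y)).

End LieAlgebraNotions.

Arguments lie_center {R} g _.

Record sasakian (R : realFieldType) (g : lieAlgType R) := Sasakian {
  sas_Phi : 'End(g);
  sas_alpha : 'Hom(g, R^o);
  sas_xi : g;
  sas_metric : {dot g for idfun};
  sas_odd_dim : odd (\dim {:g});
  sas_alpha_xi : sas_alpha sas_xi = 1;
  sas_Phi2 : forall x, sas_Phi (sas_Phi x) = - x + sas_alpha x *: sas_xi;
  sas_metric_Phi : forall x y,
    sas_metric (sas_Phi x) (sas_Phi y) =
    sas_metric x y - sas_alpha x * sas_alpha y;
  sas_contact : forall x y,
    2 * sas_metric x (sas_Phi y) = ext_d sas_alpha x y;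
  sas_normal : forall x y,
    nijenhuis sas_Phi x y = - (ext_d sas_alpha x y *: sas_xi)
}.

(** The two model algebras live on row vectors; [crd] and [bas] number the
    coordinates and the standard basis from 1 to 5. *)
Section Models.
Variable R : fieldType.
Implicit Types x y z : 'rV[R]_5.

Definition crd x (k : nat) : R := x 0 (inord k.-1).
Definition bas (k : nat) : 'rV[R]_5 := delta_mx 0 (inord k.-1).
Definition minor2 x y (i j : nat) : R := crd x i * crd y j - crd x j * crd y i.

(** Basis order: X_1, X_2, Y_1, Y_2, Z. *)
Definition h5_bracket x y : 'rV[R]_5 :=
  (minor2 x y 1 3 + minor2 x y 2 4) *: bas 5.

Definition g3_bracket x y : 'rV[R]_5 :=
  minor2 x y 1 2 *: - bas 3 + minor2 x y 1 3 *: bas 2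
  + minor2 x y 1 4 *: - bas 5 + minor2 x y 2 3 *: - bas 5.

Let crdD x y k : crd (x + y) k = crd x k + crd y k.
Proof. by rewrite /crd mxE. Qed.

Let crdN x k : crd (- x) k = - crd x k.
Proof. by rewrite /crd mxE. Qed.

Let crdZ a x k : crd (a *: x) k = a * crd x k.
Proof. by rewrite /crd mxE. Qed.

Let crd_bas i j : (0 < i <= 5)%N -> (0 < j <= 5)%N ->
  crd (bas i) j = (i == j)%:R.
Proof.
case: i j => [//|i] [//|j] /= li lj.
by rewrite /crd /bas mxE eqxx /= -val_eqE /= !inordK// eq_sym.
Qed.

Let rv5P x y : (forall k, (0 < k <= 5)%N -> crd x k = crd y k) -> x = y.
Proof.
move=> xy; apply/rowP => i; have := xy i.+1.
by rewrite /crd /= inord_val; apply; exact: ltn_ord.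
Qed.

Let crdE' := (crdD, crdN, crdZ).

Lemma h5_bilinear : bilinear_for *:%R *:%R h5_bracket.
Proof.
by split=> u a x y; apply: rv5P => k _;
  rewrite /= /h5_bracket /minor2 !crdE'; ring.
Qed.

Lemma h5_bracketxx x : h5_bracket x x = 0.
Proof.
by rewrite /h5_bracket /minor2 !(mulrC (crd x 3)) !(mulrC (crd x 4))
  !subrr addr0 scale0r.
Qed.

Lemma h5_jacobi x y z : h5_bracket x (h5_bracket y z)
  + h5_bracket y (h5_bracket z x) + h5_bracket z (h5_bracket x y) = 0.
Proof.
apply: rv5P => k _; rewrite /h5_bracket /minor2 !crdE' [RHS]mxE.
rewrite !(@crd_bas 5 1, @crd_bas 5 2, @crd_bas 5 3, @crd_bas 5 4)//=; ring.
Qed.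

Lemma g3_bilinear : bilinear_for *:%R *:%R g3_bracket.
Proof.
by split=> u a x y; apply: rv5P => k _;
  rewrite /= /g3_bracket /minor2 !crdE'; ring.
Qed.

Lemma g3_bracketxx x : g3_bracket x x = 0.
Proof.
apply: rv5P => k _; rewrite /g3_bracket /minor2 !crdE' [RHS]mxE; ring.
Qed.

Lemma g3_jacobi x y z : g3_bracket x (g3_bracket y z)
  + g3_bracket y (g3_bracket z x) + g3_bracket z (g3_bracket x y) = 0.
Proof.
apply: rv5P => k _; rewrite /g3_bracket /minor2 !crdE' [RHS]mxE.
rewrite !(@crd_bas 2 1, @crd_bas 2 2, @crd_bas 2 3, @crd_bas 2 4)//=.
rewrite !(@crd_bas 3 1, @crd_bas 3 2, @crd_bas 3 3, @crd_bas 3 4)//=.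
rewrite !(@crd_bas 5 1, @crd_bas 5 2, @crd_bas 5 3, @crd_bas 5 4)//=; ring.
Qed.

Definition h5 : Type := 'rV[R]_5.
HB.instance Definition _ := Vector.on h5.
HB.instance Definition _ :=
  Vector_isLie.Build R h5 h5_bilinear h5_bracketxx h5_jacobi.

Definition g3 : Type := 'rV[R]_5.
HB.instance Definition _ := Vector.on g3.
HB.instance Definition _ :=
  Vector_isLie.Build R g3 g3_bilinear g3_bracketxx g3_jacobi.

End Models.

Section Smooth.
Variables (R : realType) (V W : normedModType R).

(** For finite-dimensional [V] and open [U], this is the usual C^k class: all
    iterated directional derivatives up to order [k] exist and are continuous
    on [U]. *)
Fixpoint Ck (U : set V) (k : nat) (f : V -> W) : Prop :=
  (forall x, U x -> {for x, continuous f}) /\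
  if k is k'.+1 then
    forall v, (forall x, U x -> derivable f x v) /\ Ck U k' ('D_v f)
  else True.

Definition smooth (U : set V) (f : V -> W) : Prop := forall k, Ck U k f.

End Smooth.

Record chart (R : realType) (n : nat) (M : topologicalType) := Chart {
  chart_dom : set M;
  chart_img : set 'rV[R]_n;
  chart_map : M -> 'rV[R]_n;
  chart_inv : 'rV[R]_n -> M;
  chart_dom_open : open chart_dom;
  chart_img_open : open chart_img;
  chart_map_img : forall p, chart_dom p -> chart_img (chart_map p);
  chart_inv_dom : forall x, chart_img x -> chart_dom (chart_inv x);
  chart_mapK : forall p, chart_dom p -> chart_inv (chart_map p) = p;
  chart_invK : forall x, chart_img x -> chart_map (chart_inv x) = x;
  chart_map_continuous : forall p, chart_dom p -> {for p, continuous chart_map};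
  chart_inv_continuous : forall x, chart_img x -> {for x, continuous chart_inv}
}.

HB.mixin Record isLieGroup (R : realType) (n : nat) G
    of Topological G & Group G := {
  lieG_hausdorff : hausdorff_space G;
  lieG_second_countable : @second_countable G;
  atlas : set (chart R n G);
  atlas_cover : forall p, exists2 c, atlas c & chart_dom c p;
  atlas_smooth : forall c d, atlas c -> atlas d ->
    smooth [set x | chart_img c x /\ chart_dom d (chart_inv c x)]
           (chart_map d \o chart_inv c);
  mulg_continuous : continuous (fun p : G * G => (p.1 * p.2)%g);
  invg_continuous : continuous (fun p : G => p^-1%g);
  mulg_smooth : forall c d e, atlas c -> atlas d -> atlas e ->
    smooth [set x : 'rV[R]_n * 'rV[R]_n |
             [/\ chart_img c x.1, chart_img d x.2 &
                 chart_dom e (chart_inv c x.1 * chart_inv d x.2)%g]]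
           (fun x => chart_map e (chart_inv c x.1 * chart_inv d x.2)%g);
  invg_smooth : forall c d, atlas c -> atlas d ->
    smooth [set x | chart_img c x /\ chart_dom d (chart_inv c x)^-1%g]
           (fun x => chart_map d (chart_inv c x)^-1%g)
}.

#[short(type="lieGroupType")]
HB.structure Definition LieGroup (R : realType) (n : nat) :=
  {G of Topological G & Group G & isLieGroup R n G}.

Section LieAlgebraOfLieGroup.
Variables (R : realType) (n : nat) (G : lieGroupType R n) (c : chart R n G).

(** In the chart [c], the left-invariant vector field on [G] whose value at the
    identity is [v]: its value at [x] is the image of [v] under the
    differential at the identity of left translation by [x]. *)
Definition left_invariant_field (v x : 'rV[R]_n) : 'rV[R]_n :=
  'D_v (fun y => chart_map c (chart_inv c x * chart_inv c y)%g)
       (chart_map c 1%g).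

Definition field_bracket (X Y : 'rV[R]_n -> 'rV[R]_n) (x : 'rV[R]_n) :=
  'D_(X x) Y x - 'D_(Y x) X x.

Definition tangent_bracket (v w : 'rV[R]_n) : 'rV[R]_n :=
  field_bracket (left_invariant_field v) (left_invariant_field w)
                (chart_map c 1%g).

End LieAlgebraOfLieGroup.

(** [g] is isomorphic to the tangent space of [G] at the identity, with the
    bracket of left-invariant vector fields. *)
Definition has_lie_algebra (R : realType) (n : nat) (G : lieGroupType R n)
    (g : lieAlgType R) : Prop :=
  exists c : chart R n G, [/\ atlas c, chart_dom c 1%g &
    exists2 f : {linear g -> 'rV[R]_n}, bijective f &
      forall x y, f (lie x y) = tangent_bracket c (f x) (f y)].

Section SimplyConnected.
Variables (R : realType) (T : topologicalType).

Definition path_between (p q : T) (gamma : R -> T) : Prop :=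
  [/\ {within `[0, 1], continuous gamma}, gamma 0 = p & gamma 1 = q].

Definition null_homotopic (p : T) (gamma : R -> T) : Prop :=
  exists2 H : R * R -> T,
    {within `[0, 1] `*` `[0, 1], continuous H} &
    forall t, t \in `[0, 1] ->
      [/\ H (0, t) = gamma t, H (1, t) = p, H (t, 0) = p & H (t, 1) = p].

Definition simply_connected : Prop :=
  (forall p q : T, exists gamma, path_between p q gamma) /\
  (forall (p : T) gamma, path_between p p gamma -> null_homotopic p gamma).

End SimplyConnected.

Section Lattices.
Variables (R : realType) (n : nat) (G : lieGroupType R n).
Variable (Gamma : groupClosed G).

Definition discrete_subgroup : Prop := [set` Gamma] `<=` isolated [set` Gamma].

Definition coset_rel : rel G := fun x y => (x^-1 * y)%g \in Gamma.

Lemma coset_rel_equiv : equiv_class_of coset_rel.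
Proof.
split=> [x|x y|y x z]; rewrite /coset_rel.
- by rewrite mulVg gpred1.
- by rewrite -gpredV invgM invgK.
- by move=> xyG; rewrite -(gpredMl _ xyG) -mulgA mulVKg.
Qed.

Canonical coset_equiv := EquivRelPack coset_rel_equiv.

Definition cocompact : Prop :=
  compact [set: quotient_topology {eq_quot coset_equiv}].

End Lattices.

(* Main.v *)
Require Import Defs.
From HB Require Import structures.
From mathcomp Require Import all_boot all_order all_algebra.
From mathcomp Require Import generic_quotient sesquilinear ring lra.
From mathcomp Require Import all_classical all_reals all_analysis.

(** Classification.  A central vector is orthogonal to the image of Phi, so
    a nontrivial centre is spanned by the Reeb vector xi, and the quotient by
    it is a unimodular Kaehler Lie algebra of dimension 4 whose Kaehler form
    is, up to a factor, the cocycle of the extension.  Unimodular Kaehler Lie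
    algebras are flat; in dimension 4 this leaves R^4 and e(2) x R, and the
    extensions by the Kaehler form are h5 and g3.

    Flatness is not taken from the general theory.  In a unitary frame
    e1, e2 = J e1, e3, e4 = J e3 the Levi-Civita connection takes values in
    u(2), so the bracket depends on sixteen numbers.  Unimodularity cuts them
    down to twelve.  The trace of the connection, up to a factor the form
    x |-> tr (Phi o ad x), can be made to vanish on e2, e3, e4 by the choice
    of the frame ([adapted_pair]), which leaves nine.  Two combinations of
    Jacobi identities are then sums of squares: one is |nabla_e1 e1|^2, the
    other is the Bochner formula, |nabla e1|^2 ([jacobi_quadrics_eq0]).  Their
    vanishing kills all parameters but one number t, the speed at which e1
    rotates the plane of e3 and e4 ([frame_bracket]).  If t = 0 the algebra is
    h5, and otherwise a rescaling gives g3 ([classification]).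

    The group.  G3 is R^5 with the product of the semidirect product of R with
    the product of R and a Heisenberg group, where the factor R acts by
    rotations of angle 2 pi t on the plane and by a shear on the central
    direction.  In these coordinates the product is polynomial in the
    coordinates and in the sine and cosine of 2 pi t.  Such functions are
    stable under directional derivatives, hence smooth ([smooth_trig_row]),
    and their derivatives can be computed, which gives the bracket of
    left-invariant fields ([tangent_bracket_G3]).  The underlying space is a
    normed space and therefore simply connected.  Rotations of angle 2 pi t
    are trivial for integral t, so Z^5 is a subgroup; it is discrete, and
    every left coset meets a fixed compact box ([Z5_lattice_cobounded]). *)

Set Implicit Arguments.
Unset Strict Implicit.
Unset Printing Implicit Defensive.

Import Order.TTheory GRing.Theory Num.Theory numFieldNormedType.Exports.

Local Open Scope ring_scope.

(** * Coordinates on R^5 *)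

Section Coordinates.
Variable R : realType.
Implicit Types x y : 'rV[R]_5.

Definition row5 (a b c d e : R) : 'rV[R]_5 :=
  \row_i nth 0 [:: a; b; c; d; e] i.

Lemma crd_row5 a b c d e :
  ((crd (row5 a b c d e) 1 = a) * (crd (row5 a b c d e) 2 = b)
   * (crd (row5 a b c d e) 3 = c) * (crd (row5 a b c d e) 4 = d)
   * (crd (row5 a b c d e) 5 = e))%type.
Proof. by rewrite /crd /row5 !mxE !inordK. Qed.

Lemma crdE x (i : 'I_5) : x 0 i = crd x i.+1.
Proof. by rewrite /crd /= inord_val. Qed.

Lemma crd_inj x y : crd x 1 = crd y 1 -> crd x 2 = crd y 2 ->
  crd x 3 = crd y 3 -> crd x 4 = crd y 4 -> crd x 5 = crd y 5 -> x = y.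
Proof.
by move=> h1 h2 h3 h4 h5; apply/rowP => i; rewrite !crdE;
  case: i => -[|[|[|[|[|//]]]]].
Qed.

Lemma row5_crd x : row5 (crd x 1) (crd x 2) (crd x 3) (crd x 4) (crd x 5) = x.
Proof. by apply: crd_inj; rewrite crd_row5. Qed.

Lemma crdD x y k : crd (x + y) k = crd x k + crd y k.
Proof. by rewrite /crd mxE. Qed.

Lemma crdN x k : crd (- x) k = - crd x k.
Proof. by rewrite /crd mxE. Qed.

Lemma crdZ a x k : crd (a *: x) k = a * crd x k.
Proof. by rewrite /crd mxE. Qed.

Lemma crd0 k : crd (0 : 'rV[R]_5) k = 0.
Proof. by rewrite /crd mxE. Qed.

Lemma crd_bas i j : (0 < i <= 5)%N -> (0 < j <= 5)%N ->
  crd (bas R i) j = (i == j)%:R.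
Proof.
case: i j => [//|i] [//|j] /= li lj.
by rewrite /crd /bas mxE eqxx /= -val_eqE /= !inordK// eq_sym.
Qed.

Lemma crd_g3_bracket x y :
  ((crd (g3_bracket x y) 1 = 0) * (crd (g3_bracket x y) 2 = minor2 x y 1 3)
   * (crd (g3_bracket x y) 3 = - minor2 x y 1 2) * (crd (g3_bracket x y) 4 = 0)
   * (crd (g3_bracket x y) 5 = - minor2 x y 1 4 - minor2 x y 2 3))%type.
Proof.
by split; [do 3?split|]; rewrite /g3_bracket !(crdD, crdN, crdZ) !crd_bas //=; ring.
Qed.

Lemma h5_bracketE x y :
  h5_bracket x y = row5 0 0 0 0 (minor2 x y 1 3 + minor2 x y 2 4).
Proof.
by apply: crd_inj; rewrite /h5_bracket crdZ crd_bas// crd_row5 /= ?mulr0 ?mulr1.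
Qed.

End Coordinates.

(** * Dual bases and traces *)

Section DualBases.
Variables (R : realFieldType) (U : vectType R) (dot : {dot U for idfun}).
Local Notation "'[ u , v ]" := (dot u v).

Lemma dotC u v : '[u, v] = '[v, u].
Proof. by rewrite hermC /= expr0 mul1r. Qed.

Lemma dotDl u v w : '[u + v, w] = '[u, w] + '[v, w].
Proof. exact: linearDl. Qed.

Lemma dotZl a u v : '[a *: u, v] = a * '[u, v].
Proof. exact: linearZl_LR. Qed.

Lemma dotZr a u v : '[u, a *: v] = a * '[u, v].
Proof. by rewrite dotC dotZl dotC. Qed.

Lemma dotNl u v : '[- u, v] = - '[u, v].
Proof. by rewrite -scaleN1r dotZl mulN1r. Qed.

Lemma dotNr u v : '[u, - v] = - '[u, v].
Proof. by rewrite dotC dotNl dotC. Qed.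

Lemma dot0l u : '[0, u] = 0.
Proof. by rewrite -(scale0r u) dotZl mul0r. Qed.

Lemma dot_suml (I : finType) (F : I -> U) u :
  '[\sum_i F i, u] = \sum_i '[F i, u].
Proof. by elim/big_rec2: _ => [|i x y _ <-]; rewrite ?dot0l ?dotDl. Qed.

Lemma dot_gt0 u : u != 0 -> 0 < '[u, u].
Proof. exact: neq0_dnorm_gt0. Qed.

(** Biorthogonality makes [v] free, and a free family of full length is a
    basis; the coordinates are then read off by pairing with [u]. *)
Lemma dual_expand n (u v : 'I_n -> U) : \dim {:U} = n ->
  (forall i j, '[v i, u j] = (i == j)%:R) ->
  forall x, x = \sum_i '[x, u i] *: v i.
Proof.
move=> dimU dual x.
have dot_u (k : 'I_n -> R) j : '[\sum_i k i *: v i, u j] = k j.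
  rewrite dot_suml (bigD1 j)//= dotZl dual eqxx mulr1 big1 ?addr0// => i ij.
  by rewrite dotZl dual (negbTE ij) mulr0.
pose X := [tuple v i | i < n].
have XE (i : 'I_n) : X`_i = v i by rewrite -tnth_nth tnth_mktuple.
have freeX : free X.
  apply/freeP => k; under eq_bigr do rewrite XE.
  by move=> k0 i; rewrite -(dot_u k) k0 dot0l.
have basisX : basis_of fullv X.
  by rewrite basisEfree freeX subvf size_tuple dimU /=.
have xE : x = \sum_i coord X i x *: v i.
  by rewrite {1}(coord_basis basisX (memvf x)); apply: eq_bigr => i _; rewrite XE.
by rewrite {1}xE; apply: eq_bigr => i _; rewrite {2}xE dot_u.
Qed.

End DualBases.

Lemma lfun_traceE (R : realFieldType) (g : lieAlgType R) (f : 'End(g)) :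
  lfun_trace f = \sum_i coord (vbasis {:g}) i (f (vbasis {:g})`_i).
Proof.
apply: eq_bigr => i _; rewrite /passmx.mxof mxE /= passmx.vecof_delta.
by rewrite /passmx.rVof mxE.
Qed.

Lemma lfun_trace_orthonormal (R : realFieldType) (g : lieAlgType R)
    (dot : {dot g for idfun}) n (e : 'I_n -> g) (f : 'End(g)) :
  \dim {:g} = n -> (forall i j, dot (e i) (e j) = (i == j)%:R) ->
  lfun_trace f = \sum_i dot (f (e i)) (e i).
Proof.
move=> dimg ortho; rewrite lfun_traceE; set b := vbasis {:g}.
have fb (i : 'I_(\dim {:g})) : f b`_i = \sum_j dot b`_i (e j) *: f (e j).
  rewrite {1}(dual_expand dimg ortho b`_i) linear_sum.
  by apply: eq_bigr => j _; rewrite linearZ.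
under eq_bigr => i _.
  rewrite fb linear_sum /=; under eq_bigr => j _ do rewrite linearZ /=; over.
rewrite exchange_big /=; apply: eq_bigr => j _.
rewrite {2}(coord_basis (vbasisP {:g}) (memvf (f (e j)))) dot_suml.
by apply: eq_bigr => i _; rewrite dotZl mulrC.
Qed.

Section DotCoordinates.
Variables (R : realType) (g : lieAlgType R) (dot : {dot g for idfun}).
Variable u : 'I_5 -> g.

(** Coordinates with respect to the basis dual to [u]. *)
Definition dot_coords (x : g) : 'rV[R]_5 := \row_i dot x (u i).

Lemma dot_coords_linear : linear dot_coords.
Proof. by move=> a x y; apply/rowP => i; rewrite !mxE dotDl dotZl. Qed.

HB.instance Definition _ :=
  GRing.isLinear.Build R g 'rV[R]_5 *:%R dot_coords dot_coords_linear.

Lemma dot_coords_bij (v : 'I_5 -> g) : \dim {:g} = 5%N ->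
  (forall i j, dot (v i) (u j) = (i == j)%:R) -> bijective dot_coords.
Proof.
move=> dim5 dual; exists (fun y : 'rV[R]_5 => \sum_i y 0 i *: v i) => [x|y].
  rewrite {2}(dual_expand dim5 dual x).
  by apply: eq_bigr => i _; rewrite mxE.
apply/rowP => j; rewrite mxE dot_suml (bigD1 j)//= dotZl dual eqxx mulr1.
by rewrite big1 ?addr0// => i ij; rewrite dotZl dual (negbTE ij) mulr0.
Qed.

End DotCoordinates.

(** * The Lie bracket *)

Section LieBracket.
Variables (R : fieldType) (g : lieAlgType R).
Implicit Types x y z : g.

Lemma lieDl x y z : lie (x + y) z = lie x z + lie y z.
Proof. by have := lie_bilinear.1 z 1 x y; rewrite /= !scale1r. Qed.

Lemma lieDr x y z : lie z (x + y) = lie z x + lie z y.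
Proof. by have := lie_bilinear.2 z 1 x y; rewrite /= !scale1r. Qed.

Lemma lieC x y : lie x y = - lie y x.
Proof.
apply/eqP; rewrite -addr_eq0; have := @liexx _ g (x + y).
by rewrite lieDl !lieDr !liexx add0r addr0 => ->.
Qed.

Lemma lie0r x : lie x 0 = 0.
Proof. by apply: (addrI (lie x 0)); rewrite -lieDr !addr0. Qed.

Lemma lieZr a x y : lie x (a *: y) = a *: lie x y.
Proof. by have := lie_bilinear.2 x a y 0; rewrite /= !addr0 lie0r addr0. Qed.

Lemma lieZl a x y : lie (a *: x) y = a *: lie x y.
Proof. by rewrite lieC lieZr -scalerN -lieC. Qed.

Lemma adjointE x y : adjoint x y = lie x y.
Proof.
pose f := lie x; have fl : linear f by move=> a u v; rewrite /f lieDr lieZr.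
pose F : {linear g -> g} := HB.pack f (GRing.isLinear.Build R g g *:%R f fl).
exact: (lfunE F y).
Qed.

End LieBracket.

(** * Sasakian Lie algebras *)

Lemma common_kernel (R : fieldType) (U : vectType R) n (f : 'I_n -> U -> R) :
  (n < \dim {:U})%N ->
  (forall i a x y, f i (a *: x + y) = a * f i x + f i y) ->
  exists2 v : U, v != 0 & forall i, f i v = 0.
Proof.
move=> ltn flin; pose F (x : U) : 'rV[R]_n := \row_i f i x.
have Fl : linear F by move=> a x y; apply/rowP => i; rewrite !mxE flin.
pose FL : {linear U -> 'rV[R]_n} :=
  HB.pack F (GRing.isLinear.Build R U 'rV[R]_n *:%R F Fl).
pose h := linfun FL.
have ker0 : lker h != 0%VS.
  apply: contraTneq ltn => k0; have := limg_ker_dim h fullv.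
  rewrite k0 capv0 dimv0 add0n => <-; rewrite -leqNgt.
  by apply: leq_trans (dimvS (subvf _)) _; rewrite dimvf /dim /= mul1n.
exists (vpick (lker h)); first by rewrite vpick0.
move=> i; have := memv_pick (lker h); rewrite memv_ker lfunE /= => /eqP /rowP.
by move=> /(_ i); rewrite !mxE.
Qed.

Section SasakianFrame.
Variables (R : realType) (g : lieAlgType R) (S : sasakian g).
Implicit Types x y z : g.

Local Notation Phi := (sas_Phi S).
Local Notation alpha := (sas_alpha S).
Local Notation xi := (sas_xi S).
Local Notation "'[ u , v ]" := (sas_metric S u v).

Lemma xi_neq0 : xi != 0.
Proof.
apply/eqP => xi0; have /eqP := sas_alpha_xi S.
by rewrite xi0 linear0 eq_sym oner_eq0.
Qed.

(** Phi^2 kills xi, so Phi xi is a multiple of xi, and the factor squares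
    to 0. *)
Lemma Phi_xi : Phi xi = 0.
Proof.
have PPxi : Phi (Phi xi) = 0 by rewrite sas_Phi2 sas_alpha_xi scale1r addNr.
have := sas_Phi2 S (Phi xi); rewrite PPxi linear0 => /esym/eqP.
rewrite addrC subr_eq0 => /eqP Pxi.
move: (alpha _) Pxi => a Pxi.
move: PPxi; rewrite -Pxi linearZ /= -Pxi scalerA => /eqP.
rewrite scaler_eq0 (negbTE xi_neq0) orbF mulf_eq0 orbb => /eqP ->.
by rewrite scale0r.
Qed.

(** Compare Phi^2 (Phi x) with Phi (Phi^2 x). *)
Lemma alpha_Phi x : alpha (Phi x) = 0.
Proof.
have := sas_Phi2 S (Phi x); rewrite (sas_Phi2 S x) linearD linearN linearZ /= Phi_xi.
rewrite scaler0 addr0 => /esym/eqP; rewrite -subr_eq0 addrAC subrr add0r.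
by rewrite scaler_eq0 (negbTE xi_neq0) orbF => /eqP.
Qed.

Lemma dot_xi x : '[xi, x] = alpha x.
Proof.
have := sas_metric_Phi S xi x; rewrite Phi_xi dot0l sas_alpha_xi mul1r.
by move/esym/eqP; rewrite subr_eq0 => /eqP.
Qed.

Lemma alpha_lie x y : alpha (lie x y) = - 2 * '[x, Phi y].
Proof. by rewrite mulNr sas_contact /ext_d opprK. Qed.

Lemma dot_Phi x y : '[Phi x, y] = - '[x, Phi y].
Proof.
have hxy := alpha_lie x y; have hyx := alpha_lie y x.
by rewrite (lieC y x) linearN /= in hyx; rewrite dotC; lra.
Qed.

Lemma Phi2_horizontal x : alpha x = 0 -> Phi (Phi x) = - x.
Proof. by move=> ax; rewrite sas_Phi2 ax scale0r addr0. Qed.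

(** A central [z] satisfies |Phi z|^2 = alpha [z, Phi z] / 2 = 0, so that
    [z] is a multiple of the Reeb vector. *)
Lemma lie_center_xi z : lie_center g z -> z != 0 -> forall x, lie xi x = 0.
Proof.
move=> zc z0 x.
have Pz : Phi z = 0.
  apply/eqP; apply: contraT => /(@dot_gt0 _ _ (sas_metric S)).
  have := alpha_lie z (Phi z); rewrite zc linear0 dot_Phi => h; lra.
have := sas_Phi2 S z; rewrite Pz linear0 => /esym/eqP.
rewrite addrC subr_eq0 => /eqP zE.
have az : alpha z != 0.
  by apply: contraNneq z0 => a0; rewrite -zE a0 scale0r.
by have := zc x; rewrite -zE lieZl => /eqP; rewrite scaler_eq0 (negbTE az) => /eqP.
Qed.

(** The Koszul form: on the Kaehler quotient its differential is, up to a
    factor, the Ricci form. *)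
Definition koszul x : R := lfun_trace (Phi \o adjoint x)%VF.

Lemma koszul_linear a x y : koszul (a *: x + y) = a * koszul x + koszul y.
Proof.
rewrite /koszul !lfun_traceE mulr_sumr -big_split; apply: eq_bigr => i _ /=.
by rewrite !comp_lfunE !adjointE lieDl lieZl !linearD !linearZ.
Qed.

Hypothesis dim5 : \dim {:g} = 5%N.

Lemma unit_in_kernel n (f : 'I_n -> g -> R) : (n < 5)%N ->
  (forall i a x y, f i (a *: x + y) = a * f i x + f i y) ->
  exists2 v : g, '[v, v] = 1 & forall i, f i v = 0.
Proof.
move=> n5 fl; have [|v v0 fv] := common_kernel _ fl; first by rewrite dim5.
have vv := dot_gt0 (sas_metric S) v0.
exists ((Num.sqrt '[v, v])^-1 *: v).
  rewrite dotZl dotZr mulrA -invfM -expr2 sqr_sqrtr ?ltW// mulVf// gt_eqF//.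
move=> i; have := fl i (Num.sqrt '[v, v])^-1 v 0.
have f0 : f i 0 = 0.
  by have := fl i (-1) v v; rewrite scaleN1r addNr fv mulr0 addr0.
by rewrite addr0 f0 fv mulr0 addr0.
Qed.

(** The frame is chosen so that the Koszul form is a multiple of the dual of
    its first vector.  In dimension 5 three linear conditions leave room for
    e3, and four for e2 orthogonal to e3 and Phi e3. *)
Lemma adapted_pair : exists e2 e3 : g,
  [/\ '[e2, e2] = 1, '[e3, e3] = 1, '[e2, e3] = 0 & '[e2, Phi e3] = 0] /\
  [/\ alpha e2 = 0, alpha e3 = 0, koszul e2 = 0, koszul e3 = 0
    & koszul (Phi e3) = 0].
Proof.
pose f3 (i : 'I_3) x := nth 0 [:: alpha x; koszul x; koszul (Phi x)] i.
have [|e3 e33 f30] := @unit_in_kernel 3 f3 isT.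
  by case=> -[|[|[|//]]] i3 a x y; rewrite /f3 /= ?linearP ?koszul_linear.
pose f2 (i : 'I_4) x := nth 0 [:: alpha x; koszul x; '[x, e3]; '[x, Phi e3]] i.
have [|e2 e22 f20] := @unit_in_kernel 4 f2 isT.
  by case=> -[|[|[|[|//]]]] i4 a x y; rewrite /f2 /= ?linearP ?koszul_linear
    ?dotDl ?dotZl.
exists e2, e3; do 2!split=> //.
- exact: (f20 (Ordinal (isT : 2 < 4)%N)).
- exact: (f20 (Ordinal (isT : 3 < 4)%N)).
- exact: (f20 (Ordinal (isT : 0 < 4)%N)).
- exact: (f30 (Ordinal (isT : 0 < 3)%N)).
- exact: (f20 (Ordinal (isT : 1 < 4)%N)).
- exact: (f30 (Ordinal (isT : 1 < 3)%N)).
- exact: (f30 (Ordinal (isT : 2 < 3)%N)).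
Qed.

End SasakianFrame.

(** * Four-dimensional unimodular Kaehler Lie algebras *)

Lemma sqr_le0_eq0 (R : realFieldType) (x : R) : x ^+ 2 <= 0 -> x = 0.
Proof. by move=> x0; apply/eqP; rewrite -sqrf_eq0 eq_le x0 sqr_ge0. Qed.

(** The hypotheses are components of the Jacobi identity on e1, e2, e3 (along
    e4), on e1, e2, e4 (along e3), on e1, e3, e4 (along e2) and on e2, e3, e4
    (along e1), in the parameters of the unitary connection.  Since
    a1 = b4 - c3, the last one reads |nabla_e1 e1|^2 = 0.  After it the terms
    in t cancel in the sum of the other three with suitable signs, which is
    the Bochner formula |nabla e1|^2 = 0. *)
Lemma jacobi_quadrics_eq0 (R : realFieldType) (b1 b2 b3 b4 c1 c2 c3 c4 t : R) :
  b4 * t = (b1 - c2) ^+ 2 + b4 ^+ 2 + c4 ^+ 2 ->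
  - (c3 * t) = (b2 + c1) ^+ 2 + b3 ^+ 2 + c3 ^+ 2 ->
  b2 ^+ 2 + b3 ^+ 2 + 2 * b3 * c4 + c2 ^+ 2 + c4 ^+ 2 = 0 ->
  b1 ^+ 2 + c1 ^+ 2 + (b4 - c3) ^+ 2 = 0 ->
  [/\ b1 = 0, b2 = 0, b3 = 0 & b4 = 0] /\ [/\ c1 = 0, c2 = 0, c3 = 0 & c4 = 0].
Proof.
have ge0 := @sqr_ge0 R.
move=> j123 j124 j134 j234.
have b10 : b1 = 0.
  by apply: sqr_le0_eq0; have := ge0 c1; have := ge0 (b4 - c3); lra.
have c10 : c1 = 0.
  by apply: sqr_le0_eq0; have := ge0 b1; have := ge0 (b4 - c3); lra.
have b4c3 : b4 = c3.
  suff : b4 - c3 = 0 by lra.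
  by apply: sqr_le0_eq0; have := ge0 b1; have := ge0 c1; lra.
have sumB : (b3 + c4) ^+ 2 + b3 ^+ 2 + c4 ^+ 2
    + 2 * b2 ^+ 2 + 2 * c2 ^+ 2 + 2 * c3 ^+ 2 = 0.
  by move: j123 j124 j134; rewrite b10 c10 b4c3 => j123 j124 j134; lra.
have := (ge0 (b3 + c4), ge0 b3, ge0 c4, (ge0 b2, ge0 c2, ge0 c3)).
move=> [[[z1 z2] z3] [[z4 z5] z6]]; clear j123 j124 j134 j234.
by rewrite b4c3; split; split => //; apply: sqr_le0_eq0; lra.
Qed.

(** In a unitary frame with e2 = J e1 and e4 = J e3, the number [c i j k] is
    the component on e_k of the bracket of e_i and e_j.  The linear equations
    below say that this bracket is A_i e_j - A_j e_i for a unitary connection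
      A_k e1 =  a_k e2 + b_k e3 + c_k e4,   A_k e2 = - a_k e1 - c_k e3 + b_k e4,
      A_k e3 = - b_k e1 + c_k e2 + d_k e4,  A_k e4 = - c_k e1 - b_k e2 - d_k e3,
    whose parameters satisfy the trace conditions
      a1 = b4 - c3,  a2 = - b3 - c4,  d3 = - c1 - b2,  d4 = b1 - c2
    and the Koszul conditions a_k + d_k = 0 for k = 2, 3, 4. *)
Section StructureConstants.
Variables (R : realFieldType) (c : nat -> nat -> nat -> R).

Let jacobi i j k l : R :=
    c j k 1 * c i 1 l + c j k 2 * c i 2 l + c j k 3 * c i 3 l + c j k 4 * c i 4 l
  + (c k i 1 * c j 1 l + c k i 2 * c j 2 l + c k i 3 * c j 3 l + c k i 4 * c j 4 l)
  + (c i j 1 * c k 1 l + c i j 2 * c k 2 l + c i j 3 * c k 3 l + c i j 4 * c k 4 l).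

Hypothesis anti : forall i j k, c i j k = - c j i k.
Hypothesis jac : forall i j k l, jacobi i j k l = 0.
(* The Kaehler form e^12 + e^34 is closed. *)
Hypothesis closed123 : c 2 3 2 + c 1 3 1 + c 1 2 4 = 0.
Hypothesis closed124 : c 2 4 2 + c 1 4 1 - c 1 2 3 = 0.
Hypothesis closed134 : c 3 4 2 - c 1 4 4 - c 1 3 3 = 0.
Hypothesis closed234 : c 3 4 1 + c 2 4 4 + c 2 3 3 = 0.
(* The Nijenhuis tensor of J vanishes. *)
Hypothesis nij1 : - c 1 3 1 + c 2 4 1 + c 2 3 2 + c 1 4 2 = 0.
Hypothesis nij2 : - c 1 3 2 + c 2 4 2 - c 2 3 1 - c 1 4 1 = 0.
Hypothesis nij3 : - c 1 3 3 + c 2 4 3 + c 2 3 4 + c 1 4 4 = 0.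
Hypothesis nij4 : - c 1 3 4 + c 2 4 4 - c 2 3 3 - c 1 4 3 = 0.
(* The adjoint maps have trace 0. *)
Hypothesis tr1 : c 1 2 2 + c 1 3 3 + c 1 4 4 = 0.
Hypothesis tr2 : c 2 1 1 + c 2 3 3 + c 2 4 4 = 0.
Hypothesis tr3 : c 3 1 1 + c 3 2 2 + c 3 4 4 = 0.
Hypothesis tr4 : c 4 1 1 + c 4 2 2 + c 4 3 3 = 0.
(* The form [theta] is the opposite of the Koszul form. *)
Let theta i := c i 1 2 - c i 2 1 + c i 3 4 - c i 4 3.
Hypothesis theta2 : theta 2 = 0.
Hypothesis theta3 : theta 3 = 0.
Hypothesis theta4 : theta 4 = 0.

(** What survives is the flat connection with A_1 = diag (0, i t), all other
    A_k being 0. *)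
Lemma structure_constants_flat :
  [/\ forall k, (0 < k <= 4)%N -> c 1 2 k = 0,
      [/\ c 1 3 1 = 0, c 1 3 2 = 0 & c 1 3 3 = 0],
      [/\ c 1 4 1 = 0, c 1 4 2 = 0, c 1 4 4 = 0 & c 1 4 3 = - c 1 3 4] &
      [/\ forall k, (0 < k <= 4)%N -> c 2 3 k = 0,
          forall k, (0 < k <= 4)%N -> c 2 4 k = 0 &
          forall k, (0 < k <= 4)%N -> c 3 4 k = 0]].
Proof.
move: closed123 closed124 closed134 closed234 nij1 nij2 nij3 nij4.
move=> k1 k2 k3 k4 n1 n2 n3 n4.
have jac123_4 := jac 1 2 3 4.
have jac124_3 := jac 1 2 4 3.
have jac134_2 := jac 1 3 4 2.
have jac234_1 := jac 2 3 4 1.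
have diag i k : c i i k = 0 by have := anti i i k; lra.
have anti' := (anti 2 1, anti 3 1, anti 4 1, anti 3 2, anti 4 2, anti 4 3).
move: (tr1) (tr2) (tr3) (tr4) theta2 theta3 theta4.
rewrite /theta !(anti', diag) => t1 t2 t3 t4 h2 h3 h4.
move: jac123_4 jac124_3 jac134_2 jac234_1; rewrite /jacobi !(anti', diag).
(* The a_k and d_k are eliminated by the trace and Koszul conditions, except
   for t = a_1 + d_1. *)
pose b1 := - c 1 3 1; pose b2 := - c 2 4 2; pose b3 := - c 1 3 3.
pose b4 := - c 2 4 4; pose c1 := - c 1 4 1; pose c2 := c 2 3 2.
pose c3 := c 2 3 3; pose c4 := - c 1 4 4; pose t := c 1 3 4 - c 2 4 4.
have cE :
  ((c 1 2 1 = (c3 - b4)%R) * (c 1 2 2 = (b3 + c4)%R)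
   * (c 1 2 3 = (- c1 - b2)%R) * (c 1 2 4 = (b1 - c2)%R)
   * (c 1 3 1 = (- b1)%R) * (c 1 3 2 = (- b2)%R)
   * (c 1 3 3 = (- b3)%R) * (c 1 3 4 = (t - b4)%R)
   * (c 1 4 1 = (- c1)%R) * (c 1 4 2 = (- c2)%R)
   * (c 1 4 3 = (- t - c3)%R) * (c 1 4 4 = (- c4)%R)
   * (c 2 3 1 = c1) * (c 2 3 2 = c2)
   * (c 2 3 3 = c3) * (c 2 3 4 = c4)
   * (c 2 4 1 = (- b1)%R) * (c 2 4 2 = (- b2)%R)
   * (c 2 4 3 = (- b3)%R) * (c 2 4 4 = (- b4)%R)
   * (c 3 4 1 = (b4 - c3)%R) * (c 3 4 2 = (- b3 - c4)%R)
   * (c 3 4 3 = (c1 + b2)%R) * (c 3 4 4 = (c2 - b1)%R))%type.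
  by repeat split; rewrite /b1 /b2 /b3 /b4 /c1 /c2 /c3 /c4 /t; lra.
move=> j123 j124 j134 j234.
have [||||[b10 b20 b30 b40] [c10 c20 c30 c40]] :=
  @jacobi_quadrics_eq0 R b1 b2 b3 b4 c1 c2 c3 c4 t.
- by apply/eqP; rewrite -subr_eq0 -(mulr0 (2^-1)) -{1}j123 !cE; apply/eqP; field.
- by apply/eqP; rewrite -subr_eq0 -(mulr0 (- 2^-1)) -{1}j124 !cE; apply/eqP; field.
- by rewrite -(mulr0 (- 2^-1)) -{1}j134 !cE; field.
- by rewrite -(mulr0 (2^-1)) -{1}j234 !cE; field.
clear -cE b10 b20 b30 b40 c10 c20 c30 c40.
split; [|split|split|split]; rewrite ?cE; try lra.
all: by move=> [|[|[|[|[|?]]]]]// _; rewrite cE; lra.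
Qed.

End StructureConstants.

(** * Adapted frames and the classification *)

Section AdaptedFrame.
Variables (R : realType) (g : lieAlgType R) (S : sasakian g).
Implicit Types x y z : g.

Local Notation Phi := (sas_Phi S).
Local Notation alpha := (sas_alpha S).
Local Notation xi := (sas_xi S).
Local Notation "'[ u , v ]" := (sas_metric S u v).

(** Frames are numbered from 1, with the Reeb vector in position 5. *)
Record adapted (e : nat -> g) : Prop := Adapted {
  adapted_ortho : forall i j : 'I_5, '[e i.+1, e j.+1] = (i == j)%:R;
  adapted_xi : e 5%N = xi;
  adapted_Phi1 : Phi (e 1%N) = e 2%N;
  adapted_Phi2 : Phi (e 2%N) = - e 1%N;
  adapted_Phi3 : Phi (e 3%N) = e 4%N;
  adapted_Phi4 : Phi (e 4%N) = - e 3%N;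
  adapted_koszul : [/\ koszul S (e 2%N) = 0, koszul S (e 3%N) = 0
                     & koszul S (e 4%N) = 0]
}.

Lemma exists_adapted : \dim {:g} = 5%N -> exists e, adapted e.
Proof.
move=> dim5.
have [e2 [e3 [[d22 d33 d23 d24] [a2 a3 k2 k3 k4]]]] := adapted_pair S dim5.
pose e k := nth 0 [:: - Phi e2; e2; e3; Phi e3; xi] k.-1.
have dxx x : '[x, Phi x] = 0 by have := dot_Phi S x x; rewrite dotC; lra.
exists e; split=> //; last 3 first.
- by rewrite /e /= linearN /= Phi2_horizontal// opprK.
- by rewrite /e /= opprK.
- by rewrite /e /= Phi2_horizontal.
suff upper (i j : 'I_5) : (i <= j)%N -> '[e i.+1, e j.+1] = (i == j)%:R.
  move=> i j; have [/upper//|/ltnW/upper] := leqP i j.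
  by rewrite dotC eq_sym.
have dx x : '[x, xi] = alpha x by rewrite dotC dot_xi.
case: i j => -[|[|[|[|[|//]]]]] i5 [[|[|[|[|[|//]]]]] j5] //= _; rewrite /e /=.
all: rewrite ?dotNl ?dotNr ?dx ?linearN /= ?alpha_Phi ?sas_alpha_xi ?sas_metric_Phi.
all: rewrite ?dot_Phi ?dxx ?d22 ?d33 ?d23 ?d24 ?a2 ?a3 ?mulr0 ?subr0 ?oppr0 ?opprK //.
Qed.

Variable e : nat -> g.
Hypotheses (dim5 : \dim {:g} = 5%N) (unim : unimodular g).
Hypothesis xi_central : forall x, lie xi x = 0.
Hypothesis eP : adapted e.

Local Notation c i j k := '[lie (e i) (e j), e k].

Lemma frame_expand x : x = '[x, e 1] *: e 1 + '[x, e 2] *: e 2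
  + '[x, e 3] *: e 3 + '[x, e 4] *: e 4 + '[x, xi] *: xi.
Proof.
rewrite {1}(dual_expand dim5 (adapted_ortho eP) x).
by rewrite !big_ord_recr big_ord0 /= add0r (adapted_xi eP).
Qed.

Lemma frame_eq x y : (forall k, (0 < k <= 4)%N -> '[x, e k] = '[y, e k]) ->
  '[x, xi] = '[y, xi] -> x = y.
Proof. by move=> xy xyxi; rewrite (frame_expand x) (frame_expand y) !xy// xyxi. Qed.

Lemma frame_dot i j : (0 < i <= 5)%N -> (0 < j <= 5)%N ->
  '[e i, e j] = (i == j)%:R.
Proof.
case: i j => [//|i] [//|j] /= i5 j5.
exact: (adapted_ortho eP (Ordinal i5) (Ordinal j5)).
Qed.

Lemma lie_xi x : lie x xi = 0.
Proof. by rewrite lieC xi_central oppr0. Qed.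

Lemma dot_lie_expand x y z : '[lie x y, z] =
  '[y, e 1] * '[lie x (e 1), z] + '[y, e 2] * '[lie x (e 2), z]
  + '[y, e 3] * '[lie x (e 3), z] + '[y, e 4] * '[lie x (e 4), z].
Proof.
rewrite {1}(frame_expand y) !lieDr !lieZr lie_xi scaler0 addr0.
by rewrite !dotDl !dotZl.
Qed.

Lemma frame_alpha i : (0 < i <= 4)%N -> alpha (e i) = 0.
Proof.
move=> i4; rewrite -dot_xi -(adapted_xi eP) frame_dot//; last first.
  by case/andP: i4 => -> /leqW.
by case: i i4 => [|[|[|[|[|]]]]].
Qed.

Lemma frame_kaehler i j : '[lie (e i) (e j), xi] = - 2 * '[e i, Phi (e j)].
Proof. by rewrite dotC dot_xi alpha_lie. Qed.

Lemma frame_lie_anti i j k : c i j k = - c j i k.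
Proof. by rewrite lieC dotNl. Qed.

Lemma frame_jacobi i j k z :
    c j k 1 * '[lie (e i) (e 1), z] + c j k 2 * '[lie (e i) (e 2), z]
  + c j k 3 * '[lie (e i) (e 3), z] + c j k 4 * '[lie (e i) (e 4), z]
  + (c k i 1 * '[lie (e j) (e 1), z] + c k i 2 * '[lie (e j) (e 2), z]
  + c k i 3 * '[lie (e j) (e 3), z] + c k i 4 * '[lie (e j) (e 4), z])
  + (c i j 1 * '[lie (e k) (e 1), z] + c i j 2 * '[lie (e k) (e 2), z]
  + c i j 3 * '[lie (e k) (e 3), z] + c i j 4 * '[lie (e k) (e 4), z]) = 0.
Proof. by rewrite -!dot_lie_expand -!dotDl lie_jacobi dot0l. Qed.

Lemma frame_trace (f : 'End(g)) : lfun_trace f =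
  '[f (e 1), e 1] + '[f (e 2), e 2] + '[f (e 3), e 3] + '[f (e 4), e 4]
  + '[f xi, xi].
Proof.
rewrite (lfun_trace_orthonormal f dim5 (adapted_ortho eP)).
by rewrite !big_ord_recr big_ord0 /= add0r (adapted_xi eP).
Qed.

Lemma frame_unimodular i : c i 1 1 + c i 2 2 + c i 3 3 + c i 4 4 = 0.
Proof.
by have := unim (e i); rewrite frame_trace !adjointE lie_xi dot0l addr0.
Qed.

Lemma frame_koszul i : koszul S (e i) = - (c i 1 2 - c i 2 1 + c i 3 4 - c i 4 3).
Proof.
rewrite /koszul frame_trace !comp_lfunE !adjointE lie_xi linear0 dot0l addr0.
rewrite !dot_Phi (adapted_Phi1 eP) (adapted_Phi2 eP) (adapted_Phi3 eP).
by rewrite (adapted_Phi4 eP) !dotNr; ring.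
Qed.

Lemma frame_nijenhuis l : (0 < l <= 4)%N ->
  - c 1 3 l + c 2 4 l + '[lie (e 2) (e 3), Phi (e l)]
  + '[lie (e 1) (e 4), Phi (e l)] = 0.
Proof.
move=> l4; have := congr1 (fun x => '[x, e l]) (sas_normal S (e 1) (e 3)).
rewrite /nijenhuis !(dotDl, dotNl) dotZl dot_xi frame_alpha// mulr0 oppr0.
rewrite (adapted_Phi1 eP) (adapted_Phi3 eP) !dot_Phi !opprK.
by rewrite (Phi2_horizontal (frame_alpha l4)) dotNr => <-; ring.
Qed.

(** The equations of [structure_constants_flat] are the axioms paired with the
    frame: the component of the Jacobi identity along xi says that the Kaehler
    form is closed, and normality gives integrability.  The brackets have
    components along xi because d alpha is not 0. *)
Lemma frame_bracket : exists t : R,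
  [/\ lie (e 1) (e 2) = 2 *: xi, lie (e 3) (e 4) = 2 *: xi,
      lie (e 1) (e 3) = t *: e 4, lie (e 1) (e 4) = - t *: e 3
    & lie (e 2) (e 3) = 0 /\ lie (e 2) (e 4) = 0].
Proof.
have Phi_e := (adapted_Phi1 eP, adapted_Phi2 eP, adapted_Phi3 eP, adapted_Phi4 eP).
have [k2 k3 k4] := adapted_koszul eP.
have closed i j k := frame_jacobi i j k xi.
have c123 := closed 1 2 3; have c124 := closed 1 2 4.
have c134 := closed 1 3 4; have c234 := closed 2 3 4.
have n1 := @frame_nijenhuis 1 isT; have n2 := @frame_nijenhuis 2 isT.
have n3 := @frame_nijenhuis 3 isT; have n4 := @frame_nijenhuis 4 isT.
have u1 := frame_unimodular 1; have u2 := frame_unimodular 2.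
have u3 := frame_unimodular 3; have u4 := frame_unimodular 4.
(* The components c i j k with i < j serve as normal forms. *)
have anti := (frame_lie_anti 2 1, frame_lie_anti 3 1, frame_lie_anti 4 1,
  frame_lie_anti 3 2, frame_lie_anti 4 2, frame_lie_anti 4 3).
move: c123 c124 c134 c234 n1 n2 n3 n4 k2 k3 k4 u1 u2 u3 u4.
rewrite !frame_kaehler !Phi_e !dotNr !frame_dot //= !frame_koszul.
rewrite !anti !liexx !dot0l => c123 c124 c134 c234 n1 n2 n3 n4 k2 k3 k4 u1 u2 u3 u4.
have scale (x y : R) : y = 0 -> forall k, y = k * x -> k != 0 -> x = 0.
  by move=> -> k /esym/eqP; rewrite mulf_eq0 => /orP[/eqP->|/eqP//]; rewrite eqxx.
have [|||||||||||||||||E12 [E131 E132 E133] [E141 E142 E144 E143] [E23 E24 E34]] :=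
  @structure_constants_flat R (fun i j k => c i j k).
- exact: frame_lie_anti.
- by move=> i j k l; exact: frame_jacobi.
- by apply: (scale _ _ c123 2); rewrite ?anti; [ring|].
- by apply: (scale _ _ c124 2); rewrite ?anti; [ring|].
- by apply: (scale _ _ c134 2); rewrite ?anti; [ring|].
- by apply: (scale _ _ c234 (- 2)); rewrite ?anti; [ring|].
- exact: n1.
- exact: n2.
- exact: n3.
- exact: n4.
- by rewrite -[RHS]u1; ring.
- by rewrite -[RHS]u2 ?anti; ring.
- by rewrite -[RHS]u3 !anti; ring.
- by rewrite -[RHS]u4 !anti; ring.
- by apply: (scale _ _ k2 (- 1)); rewrite ?anti ?liexx ?dot0l; [ring|].
- by apply: (scale _ _ k3 (- 1)); rewrite ?anti ?liexx ?dot0l; [ring|].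
- by apply: (scale _ _ k4 (- 1)); rewrite ?anti ?liexx ?dot0l; [ring|].
have frame_xi k : (0 < k <= 4)%N -> '[xi, e k] = 0.
  by move=> k4'; rewrite dot_xi frame_alpha.
have xi_xi : '[xi, xi] = 1 by rewrite dot_xi sas_alpha_xi.
have xi_frame k : (0 < k <= 4)%N -> '[e k, xi] = 0.
  by move=> k4'; rewrite dotC frame_xi.
exists (c 1 3 4); split; last split; apply: frame_eq.
all: rewrite ?frame_kaehler ?Phi_e ?dotNr ?dotZl ?dot0l ?xi_xi ?frame_dot ?xi_frame //=.
all: rewrite ?mulr0 ?oppr0 ?mulr1 ?mulr0 ?mulrNN ?mulr1 //.
all: move=> k k4'; rewrite ?dotZl ?frame_xi// ?dot0l ?mulr0 ?E12 ?E34 ?E23 ?E24//.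
all: move: k k4' => [|[|[|[|[|?]]]]]// _; rewrite frame_dot//= ?mulr0 ?mulr1 //.
Qed.

End AdaptedFrame.

Section Classification.
Variables (R : realType) (g : lieAlgType R) (S : sasakian g) (e : nat -> g).
Hypotheses (dim5 : \dim {:g} = 5%N) (unim : unimodular g).
Hypothesis xi_central : forall x, lie (sas_xi S) x = 0.
Hypothesis eP : adapted S e.

Local Notation "'[ x , y ]" := (sas_metric S x y).
Local Notation minor x y i j := ('[x, e i] * '[y, e j] - '[x, e j] * '[y, e i]).

Lemma frame_dot_lie t x y :
  lie (e 1) (e 2) = 2 *: e 5 -> lie (e 3) (e 4) = 2 *: e 5 ->
  lie (e 1) (e 3) = t *: e 4 -> lie (e 1) (e 4) = - t *: e 3 ->
  lie (e 2) (e 3) = 0 -> lie (e 2) (e 4) = 0 ->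
  [/\ '[lie x y, e 1] = 0, '[lie x y, e 2] = 0,
      '[lie x y, e 3] = - t * minor x y 1 4,
      '[lie x y, e 4] = t * minor x y 1 3
    & '[lie x y, e 5] = 2 * minor x y 1 2 + 2 * minor x y 3 4].
Proof.
move=> h12 h34 h13 h14 h23 h24.
have flip i z : '[lie x (e i), z] = - '[lie (e i) x, z] by rewrite lieC dotNl.
rewrite !(dot_lie_expand dim5 xi_central eP x y) !flip.
rewrite !(dot_lie_expand dim5 xi_central eP _ x) !liexx.
rewrite ?h12 ?h13 ?h14 ?h23 ?h24 ?h34.
rewrite (lieC (e 2) (e 1)) (lieC (e 3) (e 1)) (lieC (e 4) (e 1)).
rewrite (lieC (e 3) (e 2)) (lieC (e 4) (e 2)) (lieC (e 4) (e 3)).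
rewrite ?h12 ?h13 ?h14 ?h23 ?h24 ?h34.
rewrite !(dotNl, dotZl, dot0l, frame_dot eP) //=.
by split; ring.
Qed.

(** For t = 0 the isomorphism with h5 sends e1, e3, e2, e4, 2 xi to
    X_1, X_2, Y_1, Y_2, Z.  For t != 0 the one with g3 sends
    - e1 / t, e3, e4, - t e2, - 2 xi to its basis. *)
Lemma classification :
  lie_isomorphic g (h5 R) \/ lie_isomorphic g (g3 R).
Proof.
have [t [h12 h34 h13 h14 [h23 h24]]] := frame_bracket dim5 unim xi_central eP.
rewrite -(adapted_xi eP) in h12 h34.
have dot_lie x y := frame_dot_lie x y h12 h34 h13 h14 h23 h24.
have crd_coords (u : 'I_5 -> g) x k : crd (dot_coords (sas_metric S) u x) k =
    '[x, u (inord k.-1)] by rewrite /crd mxE.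
have [t0|t0] := eqVneq t 0; [left|right].
- pose u (i : 'I_5) := nth 0 [:: e 1; e 3; e 2; e 4; 2^-1 *: e 5] i.
  pose v (i : 'I_5) := nth 0 [:: e 1; e 3; e 2; e 4; 2 *: e 5] i.
  have dual i j : '[v i, u j] = (i == j)%:R.
    case: i j => -[|[|[|[|[|//]]]]] i5 [[|[|[|[|[|//]]]]] j5];
      rewrite /u /v /= ?dotZl ?dotZr (frame_dot eP)//= ?mulr0// mulr1.
    by rewrite mulfV.
  exists (dot_coords (sas_metric S) u); first exact: dot_coords_bij dim5 dual.
  move=> x y; have [d1 d2 d3 d4 d5] := dot_lie x y.
  apply: (etrans _ (esym (h5_bracketE _ _))).
  apply: crd_inj; rewrite crd_row5 /minor2 !crd_coords /u !inordK //= ?dotZr.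
  + by rewrite d3 t0; ring.
  + by rewrite d4 t0; ring.
  + by rewrite d5; field.
- pose u (i : 'I_5) :=
    nth 0 [:: - t *: e 1; e 3; e 4; - t^-1 *: e 2; - 2^-1 *: e 5] i.
  pose v (i : 'I_5) :=
    nth 0 [:: - t^-1 *: e 1; e 3; e 4; - t *: e 2; - 2 *: e 5] i.
  have dual i j : '[v i, u j] = (i == j)%:R.
    case: i j => -[|[|[|[|[|//]]]]] i5 [[|[|[|[|[|//]]]]] j5];
      rewrite /u /v /= ?dotZl ?dotZr (frame_dot eP)//= ?mulr0// mulr1.
    + by rewrite mulrNN mulVf.
    + by rewrite mulrNN mulfV.
    + by rewrite mulrNN mulfV.
  exists (dot_coords (sas_metric S) u); first exact: dot_coords_bij dim5 dual.
  move=> x y; have [d1 d2 d3 d4 d5] := dot_lie x y.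
  have g3E (a b : 'rV[R]_5) := crd_g3_bracket a b.
  apply: crd_inj; rewrite [RHS]g3E /minor2 !crd_coords /u !inordK //= ?dotZr.
  + by rewrite d1 mulr0.
  + by rewrite d3; ring.
  + by rewrite d4; ring.
  + by rewrite d2 mulr0.
  + by rewrite d5; field.
Qed.

End Classification.

(** * Trigonometric polynomials *)

Section TrigonometricTerms.
Local Open Scope classical_set_scope.
Local Open Scope ring_scope.
Variables (R : realType) (V : normedModType R).

(** A syntax for these functions makes their derivatives computable; [Lin]
    stands for the continuous linear forms. *)
Inductive trig : Type :=
| Cst of R
| Lin (l : V -> R) of (forall a x y, l (a *: x + y) = a * l x + l y)
    & continuous l
| Add of trig & trig
| Mul of trig & trig
| Cos of trig
| Sin of trig.

Fixpoint trig_eval (e : trig) (x : V) : R :=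
  match e with
  | Cst c => c
  | Lin l _ _ => l x
  | Add e f => trig_eval e x + trig_eval f x
  | Mul e f => trig_eval e x * trig_eval f x
  | Cos e => cos (trig_eval e x)
  | Sin e => sin (trig_eval e x)
  end.

Fixpoint deriv_trig (v : V) (e : trig) : trig :=
  match e with
  | Cst _ => Cst 0
  | Lin l _ _ => Cst (l v)
  | Add e f => Add (deriv_trig v e) (deriv_trig v f)
  | Mul e f => Add (Mul (deriv_trig v e) f) (Mul e (deriv_trig v f))
  | Cos e => Mul (Mul (Cst (-1)) (Sin e)) (deriv_trig v e)
  | Sin e => Mul (Cos e) (deriv_trig v e)
  end.

(** Reduces directional derivatives to derivatives of functions of one
    variable, for which the chain rule is available. *)
Lemma is_derive_along_line (f : V -> R) (x v : V) (df : R) :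
  is_derive x v f df <->
  is_derive (0 : R) (1 : R) (fun h : R => f (h *: v + x)) df.
Proof.
suff E : (fun h : R => h^-1 *: ((f \o shift x) (h *: v) - f x)) =
    (fun h : R => h^-1 *:
      (((fun h : R => f (h *: v + x)) \o shift 0) (h *: 1) - f (0 *: v + x))).
  by split=> -[d <-]; split; rewrite /derivable /derive ?E// -?E.
by apply/funext => h /=; rewrite scale0r add0r addr0 [h *: 1]mulr1.
Qed.

Lemma is_derive_chain (g : R -> R) (f : V -> R) (x v : V) (dg df : R) :
  is_derive (f x) 1 g dg -> is_derive x v f df ->
  is_derive x v (fun y => g (f y)) (dg * df).
Proof.
move=> Hg /is_derive_along_line Hf; apply/is_derive_along_line.
have Hg' : is_derive ((fun h : R => f (h *: v + x)) 0) 1 g dg.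
  by rewrite scale0r add0r.
exact: is_derive1_comp Hg' Hf.
Qed.

Lemma is_derive_trig (e : trig) (x v : V) :
  is_derive x v (trig_eval e) (trig_eval (deriv_trig v e) x).
Proof.
elim: e => [c|l lin cont|e1 H1 e2 H2|e1 H1 e2 H2|e He|e He] /=.
- exact: is_derive_cst.
- apply/is_derive_along_line.
  have -> : (fun h : R => l (h *: v + x)) = (fun h : R => h * l v + l x).
    by apply/funext => h; rewrite lin.
  by apply: is_derive_eq; rewrite scaler1 addr0 scaler0 add0r.
- exact: is_deriveD.
- have /= := is_deriveM H1 H2.
  by move/is_derive_eq; apply; rewrite addrC /GRing.scale/=; ring.
- have H := is_derive_cos (trig_eval e x).
  by have := is_derive_chain H He; move/is_derive_eq; apply; ring.
- have H := is_derive_sin (trig_eval e x).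
  by have := is_derive_chain H He; move/is_derive_eq; apply.
Qed.

Lemma continuous_trig (e : trig) : continuous (trig_eval e).
Proof.
elim: e => [c|l lin cont|e1 H1 e2 H2|e1 H1 e2 H2|e He|e He] x /=.
- exact: cvg_cst.
- exact: cont.
- by apply: cvgD; [exact: H1|exact: H2].
- by apply: cvgM; [exact: H1|exact: H2].
- apply: continuous_comp; [exact: He|exact: continuous_cos].
- apply: continuous_comp; [exact: He|exact: continuous_sin].
Qed.

Lemma rV_continuous n (f : V -> 'rV[R]_n) (x : V) :
  (forall i, {for x, continuous (fun y => f y 0 i)}) ->
  {for x, continuous f}.
Proof.
move=> fc A [P Px PA]; rewrite /= nbhs_simpl.
have : \forall y \near x, forall i, P 0 i (f y 0 i).
  by apply: filter_forall => i; apply: fc; exact: Px.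
apply: filterS => y Py; apply: PA => i j.
by rewrite (ord1 i); exact: Py.
Qed.

Section Rows.
Variables (n : nat) (e : 'I_n -> trig).
Local Notation row_eval e := (fun x : V => \row_i trig_eval (e i) x).

Lemma trig_row_coord i :
  (fun x => row_eval e x 0 i) = trig_eval (e i).
Proof. by apply/funext => x; rewrite mxE. Qed.

Lemma derivable_trig_row x v : derivable (row_eval e) x v.
Proof.
apply/derivable_mxP => i j; rewrite (ord1 i) trig_row_coord.
by have [] := is_derive_trig (e j) x v.
Qed.

Lemma derive_trig_row x v :
  'D_v (row_eval e) x = \row_i trig_eval (deriv_trig v (e i)) x.
Proof.
rewrite derive_mx; last exact: derivable_trig_row.
apply/rowP => j; rewrite !mxE trig_row_coord.
by have [_ ->] := is_derive_trig (e j) x v.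
Qed.

End Rows.

Lemma smooth_trig_row n (U : set V) (e : 'I_n -> trig) :
  smooth U (fun x => \row_i trig_eval (e i) x).
Proof.
move=> k; elim: k e => [|k IH] e /=; split=> //.
1,2: move=> x _; apply: rV_continuous => i.
1,2: by rewrite trig_row_coord; exact: continuous_trig.
move=> v; split=> [x _|]; first exact: derivable_trig_row.
rewrite (_ : 'D_v _ = fun x => \row_i trig_eval (deriv_trig v (e i)) x) //.
by apply/funext => x; exact: derive_trig_row.
Qed.

End TrigonometricTerms.

(** * The Lie group G3 *)

Section SecondCountable.
Local Open Scope classical_set_scope.
Local Open Scope ring_scope.
Variables (R : realType) (n : nat).

Lemma row_ballE (x y : 'rV[R]_n) (e : R) :
  ball x e y <-> 0 < e /\ forall j, `|x 0 j - y 0 j| < e.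
Proof.
split=> [[e0 xy]|[e0 xy]]; split=> //; first by move=> j; exact: xy.
by move=> i j; rewrite (ord1 i); exact: xy.
Qed.

(** Balls with rational centres and rational radii form a basis. *)
Lemma rV_second_countable : @second_countable 'rV[R]_n.
Proof.
pose cball (p : 'rV[rat]_n * rat) : set 'rV[R]_n :=
  (ball (map_mx (@ratr R) p.1 : 'rV[R]_n) (ratr p.2 : R))°.
exists (range cball); first by rewrite (sub_countable (card_image_le _ _)).
split=> [_ [p _ <-]|x A /nbhs_ballP[e /= e0 xeA]]; first exact: open_interior.
have [r /andP[r0 re]] : exists r : rat, (0 : R) < ratr r < e / 2.
  have /rat_in_itvoo[r] : 0 < e / 2 by rewrite divr_gt0.
  by rewrite in_itv/= => h; exists r.
have near_rat (j : 'I_n) : exists q : rat, `|ratr q - x 0 j| < ratr r / 2.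
  have /rat_in_itvoo[q] : x 0 j - ratr r / 2 < x 0 j + ratr r / 2 by lra.
  by rewrite in_itv/= => h; exists q; rewrite ltr_norml; lra.
have [q qx] := boolp.choice near_rat.
exists (cball (\row_j q j, r)); first split; first by exists (\row_j q j, r).
  apply/nbhs_ballP; exists (ratr r / 2) => /=; first by rewrite divr_gt0.
  move=> y /row_ballE[_ xy]; apply/row_ballE; split=> // j; rewrite !mxE.
  have := ltrD (qx j) (xy j); rewrite -splitr; apply: le_lt_trans.
  by rewrite (le_trans _ (ler_normD _ _))// addrA subrK.
move=> y /interior_subset /row_ballE[_ qy]; apply: xeA.
apply/row_ballE; split=> // j.
have := qy j; rewrite !mxE => qyj; have := ltrD (qx j) qyj.
rewrite distrC => h; have : `|x 0 j - ratr (q j)| + `|ratr (q j) - y 0 j| < e.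
  lra.
by apply: le_lt_trans; rewrite (le_trans _ (ler_normD _ _))// addrA subrK.
Qed.

End SecondCountable.

Section Group.
Variable R : realType.

Local Notation tau := (2 * pi : R).

Definition G3 : Type := 'rV[R]_5.
HB.instance Definition _ := Topological.on G3.

Implicit Types p q r : G3.

Definition rotx (t x y : R) : R := cos (tau * t) * x - sin (tau * t) * y.
Definition roty (t x y : R) : R := sin (tau * t) * x + cos (tau * t) * y.

(** The last two terms are the area form on the plane, evaluated on the plane
    component of [p] and the rotated one of [q]: the cocycle of the Heisenberg
    group.  The term before them is the shear. *)
Definition G3_mul p q : G3 :=
  row5 (crd p 1 + crd q 1)
       (crd p 2 + rotx (crd p 1) (crd q 2) (crd q 3))
       (crd p 3 + roty (crd p 1) (crd q 2) (crd q 3))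
       (crd p 4 + crd q 4)
       (crd p 5 + crd q 5 + crd p 1 * crd q 4
        + crd p 2 * roty (crd p 1) (crd q 2) (crd q 3)
        - crd p 3 * rotx (crd p 1) (crd q 2) (crd q 3)).

Definition G3_one : G3 := 0.

Definition G3_inv p : G3 :=
  row5 (- crd p 1)
       (- rotx (- crd p 1) (crd p 2) (crd p 3))
       (- roty (- crd p 1) (crd p 2) (crd p 3))
       (- crd p 4)
       (- crd p 5 + crd p 1 * crd p 4).

Lemma G3_mulA : associative G3_mul.
Proof.
move=> p q r; apply: crd_inj; rewrite /G3_mul !crd_row5 /rotx /roty
  ?(mulrDr tau) ?cosD ?sinD; try ring.
(* The area form is invariant under the rotation, that is under
   cos^2 + sin^2 = 1. *)
by have h := cos2sin2 (tau * crd p 1); ring: h.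
Qed.

Lemma G3_mul1g : left_id G3_one G3_mul.
Proof.
move=> p; apply: crd_inj; rewrite /G3_mul !crd_row5 /rotx /roty /G3_one !crd0
  ?mulr0 ?cos0 ?sin0; ring.
Qed.

Lemma G3_mulg1 : right_id G3_one G3_mul.
Proof.
by move=> p; apply: crd_inj; rewrite /G3_mul !crd_row5 /rotx /roty /G3_one !crd0; ring.
Qed.

Lemma G3_mulVg : left_inverse G3_one G3_inv G3_mul.
Proof.
move=> p; apply: crd_inj; rewrite /G3_mul !crd_row5 /G3_inv ?crd_row5 /rotx /roty
  /G3_one !crd0 ?mulrN ?cosN ?sinN; ring.
Qed.

Lemma G3_mulgV : right_inverse G3_one G3_inv G3_mul.
Proof.
move=> p; apply: crd_inj; rewrite /G3_mul !crd_row5 /G3_inv ?crd_row5 /rotx /roty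
  /G3_one !crd0 ?mulrN ?cosN ?sinN;
  by have h := cos2sin2 (tau * crd p 1); ring: h.
Qed.

HB.instance Definition _ := isGroup.Build G3 G3_mulA G3_mul1g G3_mulg1
  G3_mulVg G3_mulgV.

End Group.

Section LieGroupStructure.
Local Open Scope classical_set_scope.
Local Open Scope ring_scope.
Variable R : realType.
Local Notation E5 := 'rV[R]_5.
Local Notation tau := (2 * pi : R).

Section Terms.
Variables (V : normedModType R) (l : V -> E5).
Hypothesis lin : forall a x y, l (a *: x + y) = a *: l x + l y.
Hypothesis cont : continuous l.

Lemma crd_lin k a x y : crd (l (a *: x + y)) k = a * crd (l x) k + crd (l y) k.
Proof. by rewrite lin crdD crdZ. Qed.

Lemma crd_cont k : continuous (fun x => crd (l x) k).
Proof.
move=> x; apply: (@continuous_comp _ _ _ l (fun y => crd y k)).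
  exact: cont.
exact: coord_continuous.
Qed.

Definition coord_t k : trig V := Lin (crd_lin k) (@crd_cont k).

End Terms.

Section Operations.
Variable V : normedModType R.
Implicit Types t x y : trig V.

Definition opp_t x : trig V := Mul (Cst V (-1)) x.
Definition rotx_t t x y : trig V :=
  Add (Mul (Cos (Mul (Cst V tau) t)) x) (opp_t (Mul (Sin (Mul (Cst V tau) t)) y)).
Definition roty_t t x y : trig V :=
  Add (Mul (Sin (Mul (Cst V tau) t)) x) (Mul (Cos (Mul (Cst V tau) t)) y).

Definition mul_t (p q : nat -> trig V) (i : 'I_5) : trig V :=
  nth (Cst V 0)
    [:: Add (p 1) (q 1);
        Add (p 2) (rotx_t (p 1) (q 2) (q 3));
        Add (p 3) (roty_t (p 1) (q 2) (q 3));
        Add (p 4) (q 4);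
        Add (Add (Add (p 5) (q 5)) (Mul (p 1) (q 4)))
          (Add (Mul (p 2) (roty_t (p 1) (q 2) (q 3)))
               (opp_t (Mul (p 3) (rotx_t (p 1) (q 2) (q 3)))))]%N i.

Definition inv_t (p : nat -> trig V) (i : 'I_5) : trig V :=
  nth (Cst V 0)
    [:: opp_t (p 1);
        opp_t (rotx_t (opp_t (p 1)) (p 2) (p 3));
        opp_t (roty_t (opp_t (p 1)) (p 2) (p 3));
        opp_t (p 4);
        Add (opp_t (p 5)) (Mul (p 1) (p 4))]%N i.

Lemma trig_eval_mul (p q : nat -> trig V) (v : V) (P Q : G3 R) :
  (forall k, trig_eval (p k) v = crd P k) -> (forall k, trig_eval (q k) v = crd Q k) ->
  \row_i trig_eval (mul_t p q i) v = G3_mul P Q.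
Proof.
move=> hp hq; apply/rowP => -[[|[|[|[|[|//]]]]] i5]; rewrite !mxE /= !(hp, hq) //.
all: by rewrite /rotx /roty; ring.
Qed.

Lemma trig_eval_inv (p : nat -> trig V) (v : V) (P : G3 R) :
  (forall k, trig_eval (p k) v = crd P k) ->
  \row_i trig_eval (inv_t p i) v = G3_inv P.
Proof.
move=> hp; apply/rowP => -[[|[|[|[|[|//]]]]] i5]; rewrite !mxE /= !hp //.
all: by rewrite /rotx /roty ?mulN1r.
Qed.

End Operations.

Definition coord_fst : nat -> trig (E5 * E5)%type :=
  @coord_t (E5 * E5)%type (@fst E5 E5) (fun _ _ _ => erefl) (fun x => cvg_fst).
Definition coord_snd : nat -> trig (E5 * E5)%type :=
  @coord_t (E5 * E5)%type (@snd E5 E5) (fun _ _ _ => erefl) (fun x => cvg_snd).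
Definition coord_id : nat -> trig E5 :=
  @coord_t E5 id (fun _ _ _ => erefl) (fun x => @cvg_id _ _).

Lemma G3_mul_smooth (U : set (E5 * E5)) :
  smooth U (fun x : E5 * E5 => G3_mul x.1 x.2 : E5).
Proof.
rewrite (_ : (fun x => _) = fun x => \row_i trig_eval (mul_t coord_fst coord_snd i) x).
  exact: smooth_trig_row.
by apply/funext => x; rewrite (trig_eval_mul (P := x.1) (Q := x.2)).
Qed.

Lemma G3_inv_smooth (U : set E5) : smooth U (fun x : E5 => G3_inv x : E5).
Proof.
rewrite (_ : (fun x => _) = fun x => \row_i trig_eval (inv_t coord_id i) x).
  exact: smooth_trig_row.
by apply/funext => x; rewrite (trig_eval_inv (P := x)).
Qed.

Lemma id_smooth (U : set E5) : smooth U (fun x : E5 => x).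
Proof.
rewrite [X in smooth _ X](_ : _ = fun x => \row_i trig_eval (coord_id i.+1) x).
  exact: smooth_trig_row.
by apply/funext => x; apply/rowP => i; rewrite !mxE /= crdE.
Qed.

Lemma smooth_continuous (V W : normedModType R) (f : V -> W) :
  smooth [set: V] f -> continuous f.
Proof. by move=> /(_ 0%N)[+ _] x; apply. Qed.

Definition G3_chart : chart R 5 (G3 R).
refine (@Chart R 5 (G3 R) setT setT (fun p => p) (fun p => p) _ _ _ _ _ _ _ _).
- exact: openT.
- exact: openT.
- by [].
- by [].
- by [].
- by [].
- by move=> p _; exact: cvg_id.
- by move=> p _; exact: cvg_id.
Defined.

Lemma G3_hausdorff : hausdorff_space (G3 R).
Proof. exact: (@norm_hausdorff R E5). Qed.

Lemma G3_atlas_smooth c d : [set G3_chart] c -> [set G3_chart] d ->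
  smooth [set x | chart_img c x /\ chart_dom d (chart_inv c x)]
         (chart_map d \o chart_inv c).
Proof. by move=> -> ->; exact: id_smooth. Qed.

Lemma G3_mul_charts_smooth c d e :
  [set G3_chart] c -> [set G3_chart] d -> [set G3_chart] e ->
  smooth [set x : E5 * E5 |
           [/\ chart_img c x.1, chart_img d x.2 &
               chart_dom e (chart_inv c x.1 * chart_inv d x.2)%g]]
         (fun x => chart_map e (chart_inv c x.1 * chart_inv d x.2)%g).
Proof. by move=> -> -> ->; exact: G3_mul_smooth. Qed.

Lemma G3_inv_charts_smooth c d : [set G3_chart] c -> [set G3_chart] d ->
  smooth [set x | chart_img c x /\ chart_dom d (chart_inv c x)^-1%g]
         (fun x => chart_map d (chart_inv c x)^-1%g).
Proof. by move=> -> ->; exact: G3_inv_smooth. Qed.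

HB.instance Definition _ := isLieGroup.Build R 5 (G3 R)
  G3_hausdorff (@rV_second_countable R 5)
  (fun p => ex_intro2 _ _ G3_chart erefl I)
  G3_atlas_smooth
  (smooth_continuous (@G3_mul_smooth setT))
  (smooth_continuous (@G3_inv_smooth setT))
  G3_mul_charts_smooth G3_inv_charts_smooth.

End LieGroupStructure.

(** * The Lie algebra of G3 *)

Section LieAlgebraOfG3.
Local Open Scope classical_set_scope.
Local Open Scope ring_scope.
Variable R : realType.
Local Notation E5 := 'rV[R]_5.
Local Notation tau := (2 * pi : R).
Implicit Types v w x y : E5.

(** Left translation is affine in the coordinates of the right factor; its
    linear part, as a function of the point [p], gives the left-invariant
    field with value [v] at the identity. *)
Definition left_field_t v (p : nat -> trig E5) (i : 'I_5) : trig E5 :=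
  nth (Cst E5 0)
    [:: Cst E5 (crd v 1);
        rotx_t (p 1) (Cst E5 (crd v 2)) (Cst E5 (crd v 3));
        roty_t (p 1) (Cst E5 (crd v 2)) (Cst E5 (crd v 3));
        Cst E5 (crd v 4);
        Add (Add (Cst E5 (crd v 5)) (Mul (p 1) (Cst E5 (crd v 4))))
          (Add (Mul (p 2) (roty_t (p 1) (Cst E5 (crd v 2)) (Cst E5 (crd v 3))))
               (opp_t (Mul (p 3)
                  (rotx_t (p 1) (Cst E5 (crd v 2)) (Cst E5 (crd v 3))))))]%N i.

Lemma left_invariant_field_G3 v x :
  left_invariant_field (G3_chart R) v x =
  \row_i trig_eval (left_field_t v (coord_id R) i) x.
Proof.
rewrite /left_invariant_field.
rewrite (_ : (fun y => _) =
   fun y => \row_i trig_eval (mul_t (fun k => Cst E5 (crd x k)) (coord_id R) i) y).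
  rewrite derive_trig_row.
  by apply/rowP => -[[|[|[|[|[|//]]]]] i5]; rewrite !mxE /=; ring.
by apply/funext => y; rewrite (@trig_eval_mul R E5 _ _ y x y).
Qed.

Lemma tangent_bracket_G3 v w :
  tangent_bracket (G3_chart R) v w =
  row5 0 (- tau * minor2 v w 1 3) (tau * minor2 v w 1 2) 0
       (minor2 v w 1 4 + 2 * minor2 v w 2 3).
Proof.
rewrite /tangent_bracket /field_bracket.
have fieldE u : left_invariant_field (G3_chart R) u =
    fun x => \row_i trig_eval (left_field_t u (coord_id R) i) x.
  by apply/funext => x; exact: left_invariant_field_G3.
have field0 u : left_invariant_field (G3_chart R) u (chart_map (G3_chart R) 1%g) = u.
  rewrite left_invariant_field_G3 -[RHS]row5_crd.
  by apply/rowP => -[[|[|[|[|[|//]]]]] i5];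
    rewrite !mxE /= ?crd0 ?mulr0 ?cos0 ?sin0; ring.
rewrite !field0 !fieldE !derive_trig_row /minor2.
apply/rowP => -[[|[|[|[|[|//]]]]] i5]; rewrite !mxE /= ?crd0 ?mulr0 ?cos0 ?sin0.
all: ring.
Qed.

(** The scaling by 2 pi undoes the choice of rotations of angle 2 pi t, and
    the factor 2 that of the full area form as cocycle. *)
Definition g3_to_tangent (x : g3 R) : E5 :=
  row5 (- crd x 1 / tau) (crd x 2) (crd x 3) (- (2 * tau) * crd x 4)
       (- 2 * crd x 5).

Lemma g3_to_tangent_linear : linear g3_to_tangent.
Proof.
move=> a x y; apply: crd_inj; rewrite /g3_to_tangent !(crdD, crdZ, crd_row5).
all: ring.
Qed.

HB.instance Definition _ :=
  GRing.isLinear.Build R (g3 R) E5 *:%R g3_to_tangent g3_to_tangent_linear.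

Lemma g3_to_tangent_bij : bijective g3_to_tangent.
Proof.
have p0 : (pi : R) != 0 by rewrite gt_eqF// pi_gt0.
exists (fun x => row5 (- tau * crd x 1) (crd x 2) (crd x 3)
                (- (2 * tau)^-1 * crd x 4) (- 2^-1 * crd x 5)) => x.
all: apply: crd_inj; rewrite /g3_to_tangent !crd_row5 //.
all: by move: (pi : R) p0 => P P0; field.
Qed.

Lemma g3_to_tangent_bracket (x y : g3 R) :
  g3_to_tangent (lie x y) =
  tangent_bracket (G3_chart R) (g3_to_tangent x) (g3_to_tangent y).
Proof.
have p0 : (pi : R) != 0 by rewrite gt_eqF// pi_gt0.
rewrite tangent_bracket_G3 /minor2 {1}/g3_to_tangent.
rewrite !(crd_g3_bracket x y) /minor2 /g3_to_tangent !crd_row5.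
by apply: crd_inj; rewrite !crd_row5; move: (pi : R) p0 => P P0; field.
Qed.

Lemma G3_has_lie_algebra : has_lie_algebra (G3 R) (g3 R).
Proof.
exists (G3_chart R); split=> //; exists g3_to_tangent; first exact: g3_to_tangent_bij.
exact: g3_to_tangent_bracket.
Qed.

End LieAlgebraOfG3.

(** * Simple connectedness *)

Section SimplyConnected.
Local Open Scope classical_set_scope.
Local Open Scope ring_scope.
Variable R : realType.

(** Loops are contracted along segments to the base point. *)
Lemma normedModType_simply_connected (V : normedModType R) :
  simply_connected R V.
Proof.
split=> [p q|p gamma [gammac g0 g1]].
  exists (fun t : R => p + t *: (q - p)); split.
  - apply: continuous_subspaceT => t; apply: cvgD; first exact: cvg_cst.
    by apply: cvgZr_tmp; exact: cvg_id.
  - by rewrite scale0r addr0.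
  - by rewrite scale1r addrC subrK.
exists (fun st : R * R => gamma st.2 + st.1 *: (p - gamma st.2)).
  apply/subspace_continuousP => -[s t] [/= s01 t01].
  have snd_cvg : (fun st : R * R => gamma st.2) @
      within (`[0, 1] `*` `[0, 1]) (nbhs (s, t)) --> gamma t.
    apply: (@cvg_comp _ _ _ snd gamma _ (within `[0, 1] (nbhs t))).
      move=> A tA; exists (setT, [set b | b \in `[0, 1] -> A b]).
        by split; [exact: filterT|exact: tA].
      by move=> [a b] [/= _ +] [_ b01]; apply.
    by move/subspace_continuousP: gammac; exact.
  apply: cvgD => //; apply: cvgZ; last by apply: cvgB => //; exact: cvg_cst.
  by apply: cvg_within_filter; exact: cvg_fst.
move=> t _; rewrite scale0r addr0 scale1r addrC subrK; split=> //=.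
  by rewrite g0 subrr scaler0 addr0.
by rewrite g1 subrr scaler0 addr0.
Qed.

End SimplyConnected.

(** * The lattice *)

Section Lattice.
Local Open Scope classical_set_scope.
Local Open Scope quotient_scope.
Local Open Scope ring_scope.
Variable R : realType.
Local Notation tau := (2 * pi : R).
Implicit Types p q : G3 R.

Lemma cos_sin_int (t : R) : t \is a Num.int ->
  cos (tau * t) = 1 /\ sin (tau * t) = 0.
Proof.
have nat_case n : cos (tau * n%:R) = 1 /\ sin (tau * n%:R) = 0.
  have -> : tau * n%:R = 0 + (pi *+ 2) *+ n by rewrite mulr_natr mulr_natl add0r.
  rewrite (periodicn (@cosD2pi R)) (periodicn (@sinD2pi R)).
  by rewrite cos0 sin0.
case/intrP => -[n|n] ->; first exact: nat_case.
have [c s] := nat_case n.+1.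
by rewrite NegzE mulrNz mulrN cosN sinN -pmulrn c s oppr0.
Qed.

Lemma rotx_int (t x y : R) : t \is a Num.int -> rotx t x y = x.
Proof.
by move=> /cos_sin_int[c s]; rewrite /rotx c s mul1r mul0r subr0.
Qed.

Lemma roty_int (t x y : R) : t \is a Num.int -> roty t x y = y.
Proof.
by move=> /cos_sin_int[c s]; rewrite /roty c s mul1r mul0r add0r.
Qed.

Lemma G3_mulE p q : (p * q)%g = G3_mul p q. Proof. by []. Qed.
Lemma G3_oneE : 1%g = G3_one R. Proof. by []. Qed.
Lemma G3_invE p : p^-1%g = G3_inv p. Proof. by []. Qed.

Definition Z5_lattice : {pred G3 R} :=
  fun p => [&& crd p 1 \is a Num.int, crd p 2 \is a Num.int,
     crd p 3 \is a Num.int, crd p 4 \is a Num.int & crd p 5 \is a Num.int].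

Lemma Z5_latticeP p :
  reflect [/\ crd p 1 \is a Num.int, crd p 2 \is a Num.int,
     crd p 3 \is a Num.int, crd p 4 \is a Num.int & crd p 5 \is a Num.int]
    (p \in Z5_lattice).
Proof. exact: and5P. Qed.

Lemma Z5_lattice_mul : mulg_closed Z5_lattice.
Proof.
move=> p q /Z5_latticeP[p1 p2 p3 p4 p5] /Z5_latticeP[q1 q2 q3 q4 q5].
apply/Z5_latticeP; rewrite G3_mulE /G3_mul !crd_row5 !rotx_int ?roty_int//.
by split=> //; do ?[apply: rpredB|apply: rpredD|apply: rpredM].
Qed.

Lemma Z5_lattice_one : (1%g : G3 R) \in Z5_lattice.
Proof. by apply/Z5_latticeP; rewrite G3_oneE /G3_one !crd0 rpred0. Qed.

Lemma Z5_lattice_inv : invg_closed Z5_lattice.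
Proof.
move=> p /Z5_latticeP[p1 p2 p3 p4 p5].
apply/Z5_latticeP; rewrite G3_invE /G3_inv !crd_row5.
rewrite !rotx_int ?roty_int ?rpredN//.
by split; rewrite ?rpredN// addrC rpredB ?rpredM.
Qed.

HB.instance Definition _ := isMulClosed.Build (G3 R) Z5_lattice Z5_lattice_mul.
HB.instance Definition _ := isMul1Closed.Build (G3 R) Z5_lattice Z5_lattice_one.
HB.instance Definition _ := isInvClosed.Build (G3 R) Z5_lattice Z5_lattice_inv.

Lemma int_dist_lt1 (x y : R) : x \is a Num.int -> y \is a Num.int ->
  `|x - y| < 1 -> x = y.
Proof.
move=> xi yi; apply: contraTeq => xy.
by rewrite -leNgt norm_intr_ge1 ?rpredB ?subr_eq0.
Qed.

Lemma Z5_lattice_discrete : discrete_subgroup Z5_lattice.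
Proof.
move=> p /= pG; split; first by rewrite inE.
exists (ball (p : 'rV[R]_5) 1); first exact: nbhsx_ballx.
apply/seteqP; split=> [q [/row_ballE[_ pq] qG]|_ ->]; last first.
  by split=> //; exact: ballxx.
have /Z5_latticeP[p1 p2 p3 p4 p5] := pG.
have /Z5_latticeP[q1 q2 q3 q4 q5] := qG.
by apply: crd_inj; apply: int_dist_lt1 => //; rewrite distrC; exact: pq.
Qed.

Lemma shift_int (r : R) : exists2 n : R, n \is a Num.int & `|r + n| <= 1.
Proof.
exists (- (Num.floor r)%:~R); first by rewrite rpredN intr_int.
have := floor_itv r; rewrite intrD => /andP[h1 h2].
by rewrite ler_norml; lra.
Qed.

Lemma rot_bound (t a b : R) : `|a| <= 1 -> `|b| <= 1 ->
  `|rotx t a b| <= 2 /\ `|roty t a b| <= 2.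
Proof.
have sin1 x : `|sin x : R| <= 1 by rewrite ler_norml sin_geN1 sin_le1.
have cos1 x : `|cos x : R| <= 1 by rewrite ler_norml cos_geN1 cos_le1.
move=> a1 b1; split; [rewrite (le_trans (ler_normB _ _))//|
  rewrite (le_trans (ler_normD _ _))//]; rewrite !normrM (_ : 2 = 1 * 1 + 1 * 1).
all: by rewrite ?lerD ?ler_pM ?mulr1.
Qed.

(** The plane component of [p * g] is the rotation of what the plane component
    of [p] becomes when it is rotated back and translated by an integral
    vector; the latter can be brought to [-1, 1]^2, whence the bound 2.  The
    central coordinate of [g] only translates that of the product, so it is
    chosen last. *)
Lemma Z5_lattice_cobounded p : exists2 g, g \in Z5_lattice &
  forall i, `|((p * g)%g : 'rV[R]_5) 0 i| <= 2.
Proof.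
have [n1 n1i n1b] := shift_int (crd p 1).
have [n2 n2i n2b] := shift_int (rotx (- crd p 1) (crd p 2) (crd p 3)).
have [n3 n3i n3b] := shift_int (roty (- crd p 1) (crd p 2) (crd p 3)).
have [n4 n4i n4b] := shift_int (crd p 4).
have [n5 n5i n5b] := shift_int (crd (p * (row5 0 n2 n3 n4 0 : G3 R))%g 5).
exists (row5 n1 n2 n3 n4 n5); first by apply/Z5_latticeP; rewrite !crd_row5.
have [bx by_] := rot_bound (crd p 1) n2b n3b.
have crd_all (x : 'rV[R]_5) : `|crd x 1| <= 2 -> `|crd x 2| <= 2 ->
    `|crd x 3| <= 2 -> `|crd x 4| <= 2 -> `|crd x 5| <= 2 ->
    forall i, `|x 0 i| <= 2.
  rewrite -{6}[x]row5_crd => h1 h2 h3 h4 h5.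
  by case=> -[|[|[|[|[|//]]]]] i5; rewrite mxE.
have le12 (x : R) : `|x| <= 1 -> `|x| <= 2 by move=> /le_trans; apply; lra.
apply: crd_all; rewrite G3_mulE /G3_mul !crd_row5.
- exact: le12.
- apply: le_trans bx; rewrite le_eqVlt; apply/orP; left; apply/eqP; congr (`|_|).
  rewrite /rotx /roty mulrN cosN sinN.
  by have h := cos2sin2 (tau * crd p 1); ring: h.
- apply: le_trans by_; rewrite le_eqVlt; apply/orP; left; apply/eqP; congr (`|_|).
  rewrite /rotx /roty mulrN cosN sinN.
  by have h := cos2sin2 (tau * crd p 1); ring: h.
- exact: le12.
- apply: le12; apply: le_trans n5b; rewrite G3_mulE /G3_mul !crd_row5.
  by rewrite le_eqVlt; apply/orP; left; apply/eqP; congr (`|_|); ring.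
Qed.

Lemma Z5_lattice_cocompact : cocompact Z5_lattice.
Proof.
pose K : set (G3 R) := [set p : 'rV[R]_5 | forall i, `[-2, 2]%classic (p ord0 i)].
have Kc : compact K.
  by apply: (@rV_compact R 5 (fun=> `[-2, 2]%classic)) => _; exact: segment_compact.
pose Q := quotient_topology {eq_quot (coset_equiv Z5_lattice)}.
rewrite /cocompact (_ : setT = (\pi_Q : G3 R -> Q) @` K).
  apply: continuous_compact => //; apply: continuous_subspaceT.
  exact: pi_continuous.
apply/seteqP; split=> // q _.
have [g gG gb] := Z5_lattice_cobounded (repr q).
exists (repr q * g)%g.
  by move=> i /=; rewrite in_itv/= -ler_norml; exact: gb.
rewrite -[RHS]reprK; apply/esym/eqmodP => /=.
by rewrite /coset_rel mulKg.
Qed.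

End Lattice.

Theorem corollary4p2 (R : realType) :
  (forall (g : lieAlgType R) (S : sasakian g),
     \dim {:g} = 5%N -> unimodular g -> (exists2 z : g, lie_center g z & z != 0) ->
     lie_isomorphic g (h5 R) \/ lie_isomorphic g (g3 R)) /\
  (exists G : lieGroupType R 5,
     [/\ simply_connected R G, has_lie_algebra G (g3 R) &
         exists2 Gamma : groupClosed G,
           discrete_subgroup Gamma & cocompact Gamma]).
Proof.
split=> [g S dim5 unim [z zc z0]|].
  have [e eP] := exists_adapted S dim5.
  apply: (classification dim5 unim _ eP); exact: lie_center_xi zc z0.
exists (G3 R); split.
- exact: (@normedModType_simply_connected R 'rV[R]_5).
- exact: G3_has_lie_algebra.
- exists (@Z5_lattice R : groupClosed (G3 R)).
    exact: Z5_lattice_discrete.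
  exact: Z5_lattice_cocompact.
Qed.
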